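(* Let $n\ge 1$. For every $(v_0,v)\in\mathbb{R}\times\mathbb{R}^{n}$, the Eigen-CG inequality $$\sum_{1\le i<j\le n}\lceil 2v_iv_j\rceil X_{i,j}+\sum_{i=1}^n\lceil v_i^2+2v_iv_0\rceil x_i+\lfloor v_0^2\rfloor\ \ge\ 0$$ is valid for $\mathrm{QPB}_n$, i.e., it is satisfied by every $(x,X)\in \mathrm{QPB}_n$.
   Context: $\mathrm{QPB}_n=\operatorname{conv}\{(x,X)\in[0,1]^{n+\binom{n+1}{2}} : X_{i,j}=x_ix_j,\ 1\le i\le j\le n\}$, where $x=(x_i)_{1\le i\le n}$, $X=(X_{i,j})_{1\le i\le j\le n}$ (note that the diagonal variables $X_{i,i}$ are included and $x$ is continuous), and $\operatorname{conv}$ denotes the convex hull. *)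

(* Defs.v *)
From HB Require Import structures.
From mathcomp Require Import all_boot all_order all_algebra.
From mathcomp Require Import classical_sets reals interval_inference convex.

Set Implicit Arguments.
Unset Strict Implicit.
Unset Printing Implicit Defensive.

Import Order.TTheory GRing.Theory Num.Theory.

Local Open Scope classical_set_scope.
Local Open Scope ring_scope.

Definition convex_hull (R : numDomainType) (E : lmodType R) (S : set E) : set E :=
  smallest (@convex_set R E) S.

(* The index set of X: pairs (i, j) with i <= j, of cardinality 'C(n.+1, 2). *)
Definition upair (n : nat) : finType := {p : 'I_n * 'I_n | (p.1 <= p.2)%N}.

(* Points (x, X) of R^(n + 'C(n.+1, 2)); R^o provides the R-module structure. *)
Definition qpb_space (R : realType) (n : nat) : lmodType R :=
  ('rV[R]_n * {ffun upair n -> R^o})%type.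

Definition QPB (R : realType) (n : nat) : set (qpb_space R n) :=
  convex_hull
    [set xX : qpb_space R n |
      [/\ forall i : 'I_n, 0 <= xX.1 0 i <= 1,
          forall p : upair n, 0 <= xX.2 p <= 1 &
          forall p : upair n,
            xX.2 p = xX.1 0 (val p).1 * xX.1 0 (val p).2]].
Arguments QPB R n : clear implicits.

(* Main.v *)
Require Import Defs.
From mathcomp Require Import all_boot all_order all_algebra.
From mathcomp Require Import classical_sets reals.
From mathcomp Require Import interval_inference convex ring.

Set Implicit Arguments.
Unset Strict Implicit.
Unset Printing Implicit Defensive.

Import Order.TTheory GRing.Theory Num.Theory.
Local Open Scope classical_set_scope.
Local Open Scope ring_scope.

(** The set of points satisfying the inequality is a half-space, hence convex, so
    it is enough to check the generators [(x, X)] with [X_ij = x_i x_j] and [x]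
    in the cube.  There the left-hand side is a function of [x] alone, and since
    only the products [x_i x_j] with [i < j] occur, it is affine in each
    coordinate separately ([multiaffine_eigen_cg]).  Such a function is
    nonnegative on the cube as soon as it is nonnegative on the 0/1 points
    ([multiaffine_ge0]).

    At a 0/1 point the left-hand side is an integer.  As [x_i ^ 2 = x_i] there,
    the same expression without roundings is the square
    [(v0 + \sum_i v_i x_i) ^ 2], which is nonnegative.  Rounding the
    coefficients of the nonnegative quantities [x_i x_j] and [x_i] up can only
    increase it, and rounding the constant [v0 ^ 2] down loses less than 1.  So
    the left-hand side is an integer greater than -1, that is, it is nonnegative
    ([eigen_cg_vertex]). *)

Definition set_coord (R : Type) (n : nat) (x : 'rV[R]_n) (i : 'I_n) (t : R) :
    'rV[R]_n :=
  \row_j (if j == i then t else x 0 j).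

(** Being affine in each coordinate is encoded by interpolation between the two
    opposite facets [x_i = 0] and [x_i = 1], the form in which the reduction to
    0/1 points uses it. *)
Definition multiaffine (R : pzRingType) (n : nat) (f : 'rV[R]_n -> R) : Prop :=
  forall x i, f x = (1 - x 0 i) * f (set_coord x i 0) + x 0 i * f (set_coord x i 1).

Section MultiaffineClosure.
Variables (R : comPzRingType) (n : nat).
Implicit Types f g : 'rV[R]_n -> R.

Lemma multiaffine_cst c : multiaffine (fun _ : 'rV[R]_n => c).
Proof. by move=> x i; ring. Qed.

Lemma multiaffineD f g :
  multiaffine f -> multiaffine g -> multiaffine (fun x => f x + g x).
Proof. by move=> hf hg x i; rewrite {1}(hf x i) {1}(hg x i); ring. Qed.

Lemma multiaffineZ c f : multiaffine f -> multiaffine (fun x => c * f x).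
Proof. by move=> hf x i; rewrite {1}(hf x i); ring. Qed.

Lemma multiaffine_sum (I : Type) (r : seq I) (P : pred I)
    (F : I -> 'rV[R]_n -> R) :
  (forall k, P k -> multiaffine (F k)) ->
  multiaffine (fun x => \sum_(k <- r | P k) F k x).
Proof.
move=> hF x i; rewrite !mulr_sumr -big_split.
by apply: eq_bigr => k /hF; apply.
Qed.

Lemma multiaffine_coord j : multiaffine (fun x : 'rV[R]_n => x 0 j).
Proof. by move=> x i; rewrite !mxE; case: eqVneq => [->|_]; ring. Qed.

(** Distinctness matters because [x_j ^ 2] is in general not affine in [x_j];
    the inequality under study involves no square. *)
Lemma multiaffine_coordM j k :
  j != k -> multiaffine (fun x : 'rV[R]_n => x 0 j * x 0 k).
Proof.
move=> jk x i; rewrite !mxE; have [ji|_] := eqVneq j i; last first.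
  by case: eqVneq => [->|_]; ring.
by rewrite -ji eq_sym (negPf jk); ring.
Qed.

End MultiaffineClosure.

(** The value at [x] is a convex combination of the values at the two points
    where one coordinate is replaced by 0 and by 1, so the coordinates can be
    rounded one after the other. *)
Lemma multiaffine_ge0 (R : realDomainType) (n : nat) (f : 'rV[R]_n -> R) :
  multiaffine f ->
  (forall x : 'rV[R]_n, (forall i, x 0 i \in [:: 0; 1 : R]) -> 0 <= f x) ->
  forall x : 'rV[R]_n, (forall i, 0 <= x 0 i <= 1) -> 0 <= f x.
Proof.
move=> f_aff f_vertex x x01.
(* The induction is on a list of coordinates outside which [x] is already 0/1. *)
have: forall i, i \notin enum 'I_n -> x 0 i \in [:: 0; 1 : R].
  by move=> i; rewrite mem_enum.
elim: (enum _) x x01 => [|i s IHs] x x01 xs; first by apply: f_vertex => i; apply: xs.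
have /andP[xi_ge0 xi_le1] := x01 i.
have IHi t : t \in [:: 0; 1 : R] -> 0 <= f (set_coord x i t).
  move=> t01; apply: IHs => j; rewrite mxE; case: eqVneq => // ji.
    by move: t01; rewrite !inE => /orP[] /eqP->; rewrite ?lexx ?ler01.
  by move=> js; apply: xs; rewrite inE negb_or ji.
by rewrite (f_aff x i) addr_ge0// mulr_ge0 ?subr_ge0 ?IHi ?inE ?eqxx ?orbT.
Qed.

(** In the sum over all ordered pairs, the diagonal yields the squares, and the
    swap of components matches the pairs below the diagonal with those above. *)
Lemma sqr_sum_upair (R : comPzRingType) (n : nat) (y : 'I_n -> R) :
  (\sum_i y i) ^+ 2 = \sum_i y i ^+ 2
    + \sum_(p : upair n | ((val p).1 < (val p).2)%N)
        2 * (y (val p).1 * y (val p).2).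
Proof.
pose F (q : 'I_n * 'I_n) := y q.1 * y q.2.
have -> : \sum_(p : upair n | ((val p).1 < (val p).2)%N)
    2 * (y (val p).1 * y (val p).2) = \sum_(q : 'I_n * 'I_n | (q.1 < q.2)%N) 2 * F q.
  rewrite -(big_sub_cond _ (fun q : 'I_n * 'I_n => (q.1 < q.2)%N)
             (fun q : 'I_n * 'I_n => 2 * F q)).
  apply: eq_bigl => q.
  by apply/andP/idP => [[]//|lt_q]; split=> //; apply: ltnW lt_q.
have -> : \sum_i y i ^+ 2 = \sum_(q : 'I_n * 'I_n | q.1 == q.2) F q.
  rewrite (partition_big fst xpredT) //=; apply: eq_bigr => i _.
  rewrite (big_pred1 (i, i)) ?expr2 // => -[a b] /=.
  by rewrite xpair_eqE andbC; case: eqVneq => //= ->; rewrite eq_sym.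
rewrite expr2 big_distrlr /= pair_bigA /= (bigID (fun q : 'I_n * 'I_n => q.1 == q.2)) /=.
congr (_ + _); rewrite (bigID (fun q : 'I_n * 'I_n => (q.1 < q.2)%N)) /=.
have -> : \sum_(q : 'I_n * 'I_n | (q.1 != q.2) && ~~ (q.1 < q.2)%N) F q
          = \sum_(q : 'I_n * 'I_n | (q.1 < q.2)%N) F q.
  rewrite (reindex_inj (h := fun q => (q.2, q.1))); last by move=> [a b] [c d] [-> ->].
  apply: eq_big => [[a b]|q _] /=; last by rewrite /F mulrC.
  by rewrite -(inj_eq val_inj) /=; case: ltngtP.
have -> : \sum_(q : 'I_n * 'I_n | (q.1 != q.2) && (q.1 < q.2)%N) F q
          = \sum_(q : 'I_n * 'I_n | (q.1 < q.2)%N) F q.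
  by apply: eq_bigl => -[a b] /=; rewrite -(inj_eq val_inj) /=; case: ltngtP.
by rewrite -big_split; apply: eq_bigr => q _; rewrite mulr_natl mulr2n.
Qed.

Section EigenCG.
Variables (R : realType) (n : nat) (v0 : R) (v : 'rV[R]_n).

Definition eigen_cg_form (x : 'rV[R]_n) (X : {ffun upair n -> R^o}) : R :=
  (\sum_(p : upair n | ((val p).1 < (val p).2)%N)
      (Num.ceil (2 * v 0 (val p).1 * v 0 (val p).2))%:~R * (X p : R))
  + (\sum_(i < n) (Num.ceil (v 0 i ^+ 2 + 2 * v 0 i * v0))%:~R * x 0 i)
  + (Num.floor (v0 ^+ 2))%:~R.

(** The left-hand side at the generator of the hull determined by [x]. *)
Definition eigen_cg_quadratic (x : 'rV[R]_n) : R :=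
  eigen_cg_form x [ffun p => x 0 (val p).1 * x 0 (val p).2].

Lemma multiaffine_eigen_cg : multiaffine eigen_cg_quadratic.
Proof.
apply: multiaffineD; last exact: multiaffine_cst.
apply: multiaffineD; apply: multiaffine_sum => k.
  move=> lt_k; apply: multiaffineZ => x i; rewrite !ffunE.
  by apply: multiaffine_coordM; rewrite -(inj_eq val_inj) ltn_eqF.
by move=> _; apply: multiaffineZ; apply: multiaffine_coord.
Qed.

(** Integrality turns the strict lower bound [-1], inherited from a square, into
    the bound [0]: this is the Chvatal-Gomory rounding step. *)
Lemma eigen_cg_vertex (x : 'rV[R]_n) :
  (forall i, x 0 i \in [:: 0; 1 : R]) -> 0 <= eigen_cg_quadratic x.
Proof.
move=> x01.
have x_ge0 i : 0 <= x 0 i by have := x01 i; rewrite !inE => /orP[] /eqP->.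
have x_sq i : x 0 i ^+ 2 = x 0 i.
  by have := x01 i; rewrite !inE => /orP[] /eqP->; rewrite ?expr0n ?expr1n.
have x_int i : x 0 i \is a Num.int.
  by have := x01 i; rewrite !inE => /orP[] /eqP->; rewrite ?rpred0 ?rpred1.
have /intrP[m defm] : eigen_cg_quadratic x \is a Num.int.
  rewrite !rpredD ?rpred_sum ?intr_int // => k _;
  by rewrite ?ffunE !rpredM ?intr_int ?x_int.
have sqr_le : (v0 + \sum_i v 0 i * x 0 i) ^+ 2 - 1 < eigen_cg_quadratic x.
  (* Expanding the square along the monomials of the inequality, with
     [x_i ^ 2] linearized to [x_i], reduces the bound to one on coefficients. *)
  have -> : (v0 + \sum_i v 0 i * x 0 i) ^+ 2 - 1 =
      \sum_(p : upair n | ((val p).1 < (val p).2)%N)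
        2 * v 0 (val p).1 * v 0 (val p).2 * (x 0 (val p).1 * x 0 (val p).2)
      + \sum_i (v 0 i ^+ 2 + 2 * v 0 i * v0) * x 0 i + (v0 ^+ 2 - 1).
    rewrite sqrrD sqr_sum_upair.
    have -> : \sum_i (v 0 i ^+ 2 + 2 * v 0 i * v0) * x 0 i =
        \sum_i (v 0 i * x 0 i) ^+ 2 + 2 * v0 * \sum_i v 0 i * x 0 i.
      rewrite mulr_sumr -big_split; apply: eq_bigr => i _ /=.
      by rewrite exprMn x_sq; ring.
    have -> : \sum_(p : upair n | ((val p).1 < (val p).2)%N)
        2 * v 0 (val p).1 * v 0 (val p).2 * (x 0 (val p).1 * x 0 (val p).2)
      = \sum_(p : upair n | ((val p).1 < (val p).2)%N)
        2 * (v 0 (val p).1 * x 0 (val p).1 * (v 0 (val p).2 * x 0 (val p).2)).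
      by apply: eq_bigr => p _; ring.
    ring.
  apply: ler_ltD; last first.
    by have := floorD1_gt (v0 ^+ 2); rewrite intrD ltrBlDr.
  apply: lerD; apply: ler_sum => k _; rewrite ?ffunE.
    by rewrite ler_wpM2r ?mulr_ge0 ?ceil_ge.
  by rewrite ler_wpM2r ?ceil_ge.
(* The comparison with -1 is moved to integers, where it means being >= 0. *)
have : (-1)%:~R < m%:~R :> R.
  rewrite -defm (le_lt_trans _ sqr_le) // mulrN1z lerBrDr addNr.
  exact: sqr_ge0.
by rewrite defm ltr_int ler0z; case: m {defm} => // -[].
Qed.

(** The form is affine rather than linear: the weights must sum to 1 for its
    constant term to be reproduced. *)
Lemma eigen_cg_form_combination (t : R) x y X Y :
  eigen_cg_form (t *: x + (1 - t) *: y) (t *: X + (1 - t) *: Y)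
  = t * eigen_cg_form x X + (1 - t) * eigen_cg_form y Y.
Proof.
rewrite /eigen_cg_form !mulrDr !mulr_sumr.
have -> : forall a b c a' b' c' : R, a + b + c + (a' + b' + c') =
    (a + a') + (b + b') + (c + c') by move=> *; ring.
rewrite -!big_split; congr (_ + _ + _); last by ring.
  by apply: eq_bigr => p _; rewrite !ffunE /GRing.scale /=; ring.
by apply: eq_bigr => i _; rewrite !mxE /=; ring.
Qed.

End EigenCG.

Theorem lemma1 (R : realType) (n : nat) (n_ge1 : (1 <= n)%N)
    (v0 : R) (v : 'rV[R]_n) (x : 'rV[R]_n) (X : {ffun upair n -> R^o})
    (xX_QPB : QPB R n (x, X)) :
  (\sum_(p : upair n | ((val p).1 < (val p).2)%N)
      (Num.ceil (2 * v 0 (val p).1 * v 0 (val p).2))%:~R * (X p : R))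
  + (\sum_(i < n) (Num.ceil (v 0 i ^+ 2 + 2 * v 0 i * v0))%:~R * x 0 i)
  + (Num.floor (v0 ^+ 2))%:~R >= 0 :> R.
Proof.
rewrite -/(eigen_cg_form v0 v x X).
pose H : set (qpb_space R n) := [set yY | 0 <= eigen_cg_form v0 v yY.1 yY.2].
suff: QPB R n `<=` H by move=> /(_ _ xX_QPB).
apply: smallest_sub.
  move=> [y Y] [z Z] t; rewrite !inE /H /= => y_ge0 z_ge0.
  rewrite eigen_cg_form_combination.
  by rewrite addr_ge0 ?mulr_ge0 ?subr_ge0.
move=> [y Y] [/= y01 _ defY]; rewrite /H /=.
have -> : Y = [ffun p => y 0 (val p).1 * y 0 (val p).2].
  by apply/ffunP => p; rewrite ffunE defY.
exact: (multiaffine_ge0 (multiaffine_eigen_cg v0 v) (@eigen_cg_vertex _ _ v0 v) y01).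
Qed.
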